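(* Let $X$ and $Y$ be Banach spaces, let $F(\cdot):X\rightsquigarrow Y$ be a set valued map whose graph $\mathrm{gr}\,F(\cdot)\subset X\times Y$ is a closed set, let $p\in X$, let $G\subset Y$ be a compact set, and let $(x,y)\in \mathrm{gr}\,F(\cdot)$. Assume that $$G\subset \frac{\partial^{L}F(x,y)}{\partial p}.$$ Then $$\lim_{\delta\to 0^{+}}\frac{1}{\delta}\,h^{*}\big(y+\delta G,\,F(x+\delta p)\big)=0.$$
   Context: For Banach spaces $X,Y$, a set valued map $F(\cdot):X\rightsquigarrow Y$ assigns to each $x\in X$ a subset $F(x)\subset Y$. Its graph is $\mathrm{gr}\,F(\cdot)=\{(x,y)\in X\times Y: y\in F(x)\}$. For $D\subset Y$ and $z\in Y$, $d(z,D)=\inf_{w\in D}\|z-w\|$ is the distance from $z$ to $D$, with the convention $d(z,\emptyset)=+\infty$. The Hausdorff deviation of a set $E\subset Y$ from a set $D\subset Y$ is $$h^{*}(E,D)=\sup_{z\in E}d(z,D),$$ the supremum being taken in $[0,+\infty]$ (so it is $0$ if $E=\emptyset$). Also $y+\delta G=\{y+\delta g: g\in G\}$. Lower derivative set of $F(\cdot)$ at $(x,y)\in X\times Y$ in the direction $p\in X$: $$\frac{\partial^{L}F(x,y)}{\partial p}=\left\{u\in Y:\lim_{\delta\to 0^{+}}\frac{1}{\delta}d\big(y+\delta u,F(x+\delta p)\big)=0\right\}.$$ *)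

(* Defs.v *)
From HB Require Import structures.
From mathcomp Require Import all_boot all_order all_algebra.
From mathcomp Require Import all_classical all_reals all_analysis.

Set Implicit Arguments.
Unset Strict Implicit.
Unset Printing Implicit Defensive.

Import Order.TTheory GRing.Theory Num.Theory.
Import numFieldNormedType.Exports.

Local Open Scope classical_set_scope.
Local Open Scope ring_scope.

Definition graph_of (X Y : Type) (F : X -> set Y) : set (X * Y) :=
  [set xy | F xy.1 xy.2].

(* ereal_inf set0 = +oo, so dist_set z set0 = +oo. *)
Definition dist_set (R : realType) (Y : normedModType R) (z : Y) (D : set Y)
    : \bar R :=
  ereal_inf [set `|z - w|%:E | w in D].

Lemma dist_setE (R : realType) (Y : normedModType R) (z : Y) (D : set Y) :
  dist_set z D = edist_inf D z.
Proof.
rewrite /dist_set /edist_inf; congr ereal_inf; apply: eq_imagel => w _.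
rewrite /edist; apply/le_anti/andP; split.
  apply: le_ereal_inf_tmp => _ [r /= [r0 zr] <-]; rewrite lee_fin ltW//.
  by move: zr; rewrite -ball_normE.
apply/lee_addgt0Pr => e e0; apply: ereal_inf_lbound.
exists (`|z - w| + e) => //=; split; first by rewrite ltr_wpDl.
by rewrite -ball_normE /ball_/= ltrDl.
Qed.

(* The supremum is taken in [0, +oo], whereas ereal_sup set0 = -oo in \bar R:
   adjoining 0 to the (nonnegative) distances makes the deviation of the empty
   set 0 and changes nothing when E is nonempty. *)
Definition hausdorff_dev (R : realType) (Y : normedModType R) (E D : set Y)
    : \bar R :=
  ereal_sup (0%E |` [set dist_set z D | z in E]).

Definition lower_derivative (R : realType) (X Y : normedModType R)
    (F : X -> set Y) (x : X) (y : Y) (p : X) : set Y :=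
  [set u : Y |
    ((d^-1)%:E * dist_set (y + d *: u)%R (F (x + d *: p)%R))%E
      @[d --> (0 : R)^'+] --> 0%E].

(* Main.v *)
Require Import Defs.
From HB Require Import structures.
From mathcomp Require Import all_boot all_order all_algebra.
From mathcomp Require Import all_classical all_reals all_analysis.

Set Implicit Arguments.
Unset Strict Implicit.
Unset Printing Implicit Defensive.

Import Order.TTheory GRing.Theory Num.Theory.
Import numFieldNormedType.Exports.

Local Open Scope classical_set_scope.
Local Open Scope ring_scope.

(** The distance to a fixed set is 1-Lipschitz, so the difference quotients
    [u |-> d^-1 * d(y + d u, F (x + d p))] are all 1-Lipschitz in [u], whatever
    [d > 0]: the increment [d * (u - v)] of the point is divided by [d]
    ([dist_quotient_lip]). Pointwise convergence of an equi-Lipschitz family is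
    uniform on compact sets: if the quotient at [g] is at most [e / 2] for all
    small [d], then it is at most [e] on the ball of radius [e / 2] around [g]
    for the same [d], and compactness of [G] makes one range of [d] work for
    all of [G]. A bound [e] on the quotients that is uniform over [G] is a
    bound on the quotient of the Hausdorff deviation. *)

(** Stating convergence to [0] by upper bounds lets infinite values (distances
    to the empty set) occur away from the limit without finiteness side
    conditions. *)
Lemma ge0_cvge0P (R : realType) (T : Type) (A : set_system T)
    (FA : Filter A) (f : T -> \bar R) :
  (\near A, (0 <= f A)%E) ->
  f t @[t --> A] --> 0%E <->
  (forall e : R, 0 < e -> \near A, (f A <= e%:E)%E).
Proof.
move=> f_ge0; split=> [/fine_cvgP[f_fin /cvgr0Pnorm_le fe] e e0|fe].
  move: (fe e e0) => {}fe; near=> t.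
  have ft : f t \is a fin_num by near: t.
  rewrite -(fineK ft) lee_fin; apply: le_trans (ler_norm _) _.
  by near: t.
apply/fine_cvgP; split.
  move: (fe 1 ltr01) => f1; near=> t.
  rewrite ge0_fin_numE; last by near: t.
  by apply: le_lt_trans (ltry 1); near: t.
apply/cvgr0Pnorm_le => e e0; move: (fe e e0) => {}fe; near=> t => /=.
have ft0 : (0 <= f t)%E by near: t.
have fte : (f t <= e%:E)%E by near: t.
rewrite ger0_norm ?fine_ge0// -lee_fin fineK//.
by rewrite ge0_fin_numE//; exact: le_lt_trans fte (ltry _).
Unshelve. all: by end_near. Qed.

Lemma dist_set_ge0 (R : realType) (Y : normedModType R) (z : Y) (D : set Y) :
  (0 <= dist_set z D)%E.
Proof. by apply: le_ereal_inf_tmp => _ [w _ <-]; rewrite lee_fin. Qed.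

Lemma dist_set_triangle (R : realType) (Y : normedModType R) (z z' : Y)
    (D : set Y) :
  (dist_set z D <= `|z - z'|%:E + dist_set z' D)%E.
Proof.
rewrite -leeBlDl//; apply: le_ereal_inf_tmp => _ [w Dw <-].
rewrite leeBlDl// -EFinD; apply: ge_ereal_inf.
by exists `|z - w|%:E; [exists w|rewrite lee_fin ler_distD].
Qed.

Lemma dist_quotient_lip (R : realType) (Y : normedModType R) (d : R)
    (y u v : Y) (D : set Y) : 0 < d ->
  ((d^-1)%:E * dist_set (y + d *: u)%R D <=
   `|u - v|%:E + (d^-1)%:E * dist_set (y + d *: v)%R D)%E.
Proof.
move=> d0; rewrite lee_pdivrMl// ge0_muleDr//; last first.
  by rewrite mule_ge0 ?dist_set_ge0// lee_fin invr_ge0 ltW.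
rewrite muleA -!EFinM divff ?gt_eqF// mul1e.
apply: le_trans (dist_set_triangle _ (y + d *: v) _) _.
by rewrite [y + _]addrC addrKA -scalerBr normrZ gtr0_norm.
Qed.

Lemma hausdorff_dev_ge0 (R : realType) (Y : normedModType R) (E D : set Y) :
  (0 <= hausdorff_dev E D)%E.
Proof. by apply: ereal_sup_ubound; left. Qed.

Lemma hausdorff_dev_le (R : realType) (Y : normedModType R) (E D : set Y)
    (r : \bar R) :
  (0 <= r)%E -> (forall z, E z -> (dist_set z D <= r)%E) ->
  (hausdorff_dev E D <= r)%E.
Proof.
by move=> r0 Er; apply: ge_ereal_sup => _ [->//|[z Ez <-]]; exact: Er.
Qed.

Theorem theorem4p1 (R : realType) (X Y : completeNormedModType R)
    (F : X -> set Y) (p : X) (G : set Y) (x : X) (y : Y)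
    (closed_grF : closed (graph_of F))
    (compactG : compact G)
    (gr_xy : graph_of F (x, y))
    (G_sub : G `<=` lower_derivative F x y p) :
  ((d^-1)%:E *
     hausdorff_dev [set (y + d *: g)%R | g in G] (F (x + d *: p)%R))%E
    @[d --> (0 : R)^'+] --> 0%E.
Proof.
have quot_ge0 (h : R -> \bar R) : (forall d, (0 <= h d)%E) ->
    \forall d \near (0 : R)^'+, (0 <= (d^-1)%:E * h d)%E.
  move=> h0; near=> d; apply: mule_ge0 => //.
  by rewrite lee_fin invr_ge0; near: d; exact: nbhs_right_ge.
apply/ge0_cvge0P; first by apply: quot_ge0 => d; exact: hausdorff_dev_ge0.
move=> e e0; have e20 : 0 < e / 2 by rewrite divr_gt0.
have unif : \forall d \near (0 : R)^'+, G `<=`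
    [set g | ((d^-1)%:E * dist_set (y + d *: g)%R (F (x + d *: p)%R)
              <= e%:E)%E].
  move/compact_near_coveringP: compactG; apply => g Gg.
  have g_near : \forall d \near (0 : R)^'+,
      ((d^-1)%:E * dist_set (y + d *: g)%R (F (x + d *: p)%R)
       <= (e / 2)%:E)%E.
    have /ge0_cvge0P := G_sub g Gg; apply => //.
    by apply: quot_ge0 => d; exact: dist_set_ge0.
  near=> g' d => /=; have d0 : 0 < d by near: d; exact: nbhs_right_gt.
  apply: le_trans (dist_quotient_lip y g' g _ d0) _.
  rewrite (splitr e) EFinD; apply: leeD; first last.
    by near: d.
  by rewrite lee_fin distrC; near: g'; exact: cvgr_dist_le.
near=> d; have d0 : 0 < d by near: d; exact: nbhs_right_gt.
have dG : G `<=` [set g | ((d^-1)%:E *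
    dist_set (y + d *: g)%R (F (x + d *: p)%R) <= e%:E)%E] by near: d.
rewrite lee_pdivrMl//; apply: hausdorff_dev_le => [|_ [g Gg <-]].
  by rewrite mule_ge0// lee_fin ltW.
by rewrite -lee_pdivrMl//; exact: dG.
Unshelve. all: by end_near. Qed.
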